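(* Let $K\ge 2$ be an integer and let $\mathrm{MLY}(\sigma_K)\subset\Sigma_K\times\Sigma_K$ be the set of all mean Li--Yorke pairs of $(\Sigma_K,\sigma_K)$. Then $\dim_H \mathrm{MLY}(\sigma_K)=1$ and $\mathscr{H}^1(\mathrm{MLY}(\sigma_K))=+\infty$.
   Context: $\Sigma_K=\{0,\dots,K-1\}^{\mathbb{N}}$ with $\mathbb{N}=\{0,1,2,\dots\}$, endowed with the metric $\rho(x,y)=K^{-\delta(x,y)}$, where $\delta(x,y)=\inf\{i\ge 0:x_i\ne y_i\}$ ($\rho(x,x)=0$). The shift map $\sigma_K:\Sigma_K\to\Sigma_K$ is $(\sigma_K(x))_i=x_{i+1}$. The product $\Sigma_K\times\Sigma_K$ carries the sup metric. For a continuous self-map $f$ of a compact metric space $(X,\rho)$, a pair $(x,y)\in X\times X$ is a mean Li--Yorke pair if $\liminf_{n\to\infty}\frac1n\sum_{i=0}^{n-1}\rho(f^i(x),f^i(y))=0$ and $\limsup_{n\to\infty}\frac1n\sum_{i=0}^{n-1}\rho(f^i(x),f^i(y))>0$. $\mathscr{H}^s$ is the $s$-dimensional Hausdorff measure with no normalizing constant: $\mathscr{H}^s(A)=\lim_{\delta\to0^+}\inf\sum_i|A_i|^s$, the infimum over countable covers $(A_i)$ of $A$ with $\sup_i|A_i|<\delta$, where $|\cdot|$ denotes diameter; $\dim_H$ is Hausdorff dimension. *)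

(* Defs.v *)
From HB Require Import structures.
From mathcomp Require Import all_boot all_order all_algebra.
From mathcomp Require Import all_classical all_reals all_analysis.

Set Implicit Arguments.
Unset Strict Implicit.
Unset Printing Implicit Defensive.

Import Order.TTheory GRing.Theory Num.Theory.
Import numFieldNormedType.Exports.

Local Open Scope classical_set_scope.
Local Open Scope ring_scope.

(* The library equips T * U with the product of the balls; this is the sup
   metric inducing exactly these balls. *)
Section prod_metric.
Context {R : realFieldType} (T U : metricType R).
Implicit Types u v : T * U.

Definition prod_mdist u v : R :=
  Num.max (mdist u.1 v.1) (mdist u.2 v.2).

Lemma prod_mdist_ge0 u v : 0 <= prod_mdist u v.
Proof. by rewrite /prod_mdist le_max mdist_ge0. Qed.

Lemma prod_mdist_positivity u v : prod_mdist u v = 0 -> u = v.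
Proof.
move=> uv0; have : prod_mdist u v <= 0 by rewrite uv0.
rewrite /prod_mdist ge_max => /andP[u1 u2].
rewrite [u]surjective_pairing [v]surjective_pairing.
by congr pair; apply: mdist_positivity; apply/eqP; rewrite eq_le mdist_ge0 andbT.
Qed.

Lemma ball_prod_mdist u (d : R) : ball u d = [set v | prod_mdist u v < d].
Proof.
apply/seteqP; split=> v; rewrite /ball/= /prod_ball/= !ballEmdist/= /prod_mdist.
  by case=> u1 u2; rewrite gt_max u1 u2.
by rewrite gt_max => /andP[].
Qed.

HB.instance Definition _ := @PseudoMetric_isMetric.Build R (T * U)%type
  prod_mdist prod_mdist_ge0 prod_mdist_positivity ball_prod_mdist.

End prod_metric.

(* The parameter R only selects the field in which distances take values: the
   topology of a metricType R instance has to be inferred from the carrier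
   alone. *)
Definition fullshift (R : realType) (K : nat) : Type := nat -> 'I_K.

HB.instance Definition _ (R : realType) (K : nat) :=
  Choice.copy (fullshift R K) (nat -> 'I_K).

Section fullshift_metric.
Context {R : realType} {K : nat}.
Implicit Types x y z : fullshift R K.

(* junk value 0 if x = y *)
Definition first_diff x y : nat :=
  match pselect (exists i, x i != y i) with
  | left xy => ex_minn xy
  | right _ => 0
  end.

Definition fullshift_dist x y : R :=
  if x == y then 0 else K%:R ^- first_diff x y.

Lemma first_diff_neq x y : x != y -> x (first_diff x y) != y (first_diff x y).
Proof.
move=> /eqP xy; rewrite /first_diff; case: pselect => [h|]; first by case: ex_minnP.
by move=> /forallNP h; exfalso; apply: xy; apply/funext => i; have /negP/negPn/eqP := h i.
Qed.

Lemma first_diff_le x y i : x i != y i -> (first_diff x y <= i)%N.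
Proof.
move=> xy; rewrite /first_diff; case: pselect => [h|[]]; last by exists i.
by case: ex_minnP => m _; apply.
Qed.

Lemma fullshift_gt0 x : 0 < K%:R :> R.
Proof. by rewrite ltr0n; case: (x 0%N) => m; apply: leq_ltn_trans. Qed.

Lemma fullshift_dist_ge0 x y : 0 <= fullshift_dist x y.
Proof.
by rewrite /fullshift_dist; case: ifP => // _; rewrite invr_ge0 exprn_ge0.
Qed.

Lemma fullshift_distxx x : fullshift_dist x x = 0.
Proof. by rewrite /fullshift_dist eqxx. Qed.

Lemma fullshift_dist_positivity x y : fullshift_dist x y = 0 -> x = y.
Proof.
rewrite /fullshift_dist; case: eqP => // _ /eqP.
by rewrite invr_eq0 expf_eq0 (gt_eqF (fullshift_gt0 x)) andbF.
Qed.

Lemma fullshift_dist_sym x y : fullshift_dist x y = fullshift_dist y x.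
Proof.
rewrite /fullshift_dist eq_sym; case: ifPn => // yx; have xy := yx.
rewrite eq_sym in xy; congr (_ ^- _); apply/eqP; rewrite eqn_leq.
by rewrite !first_diff_le// eq_sym first_diff_neq.
Qed.

Lemma fullshift_dist_le x y z : x != z ->
  x (first_diff x z) != y (first_diff x z) ->
  fullshift_dist x z <= fullshift_dist x y.
Proof.
move=> xz xy; rewrite /fullshift_dist (negbTE xz).
have [xyE|_] := eqVneq x y; first by rewrite xyE eqxx in xy.
have K0 := fullshift_gt0 x.
rewrite lef_pV2 ?posrE ?exprn_gt0//; apply: ler_weXn2l.
  by rewrite -[1]/(1%:R) ler_nat -(ltr0n R).
exact: first_diff_le.
Qed.

Lemma fullshift_dist_triangle y x z :
  fullshift_dist x z <= fullshift_dist x y + fullshift_dist y z.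
Proof.
have [->|xz] := eqVneq x z.
  by rewrite fullshift_distxx addr_ge0// fullshift_dist_ge0.
have [xyE|xy] := eqVneq (x (first_diff x z)) (y (first_diff x z)); last first.
  by rewrite (le_trans (fullshift_dist_le xz xy))// lerDl fullshift_dist_ge0.
rewrite [leRHS]addrC (fullshift_dist_sym x z) (fullshift_dist_sym y z).
have zx : z != x by rewrite eq_sym.
have E : first_diff z x = first_diff x z.
  apply/eqP; rewrite eqn_leq.
  by rewrite !first_diff_le// eq_sym first_diff_neq.
have zy : z (first_diff z x) != y (first_diff z x).
  by rewrite E -xyE eq_sym first_diff_neq.
by rewrite (le_trans (fullshift_dist_le zx zy))// lerDl fullshift_dist_ge0.
Qed.

End fullshift_metric.

HB.instance Definition _ (R : realType) (K : nat) :=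
  @isMetric.Build R (fullshift R K) (@fullshift_dist R K)
    fullshift_distxx fullshift_dist_positivity fullshift_dist_sym
    fullshift_dist_triangle.

Definition shift_map (R : realType) (K : nat) (x : fullshift R K) : fullshift R K :=
  fun i => x i.+1.

Section mean_Li_Yorke.
Context {R : realType} {X : metricType R}.

Definition mean_dist (f : X -> X) (x y : X) (n : nat) : R :=
  n%:R^-1 * \sum_(i < n) mdist (iter i f x) (iter i f y).

Definition MLY (f : X -> X) : set (X * X) :=
  [set p | limn_einf (fun n => (mean_dist f p.1 p.2 n)%:E) = 0%E /\
           (0 < limn_esup (fun n => (mean_dist f p.1 p.2 n)%:E))%E].

End mean_Li_Yorke.

Section hausdorff.
Context {R : realType} {X : metricType R}.
Implicit Types (A : set X) (s : R).
Local Open Scope ereal_scope.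

(* the maximum with 0 only matters for the empty set *)
Definition diameter A : \bar R :=
  maxe 0 (ereal_sup [set (mdist x y)%:E | x in A & y in A]).

(* The empty set contributes 0 even for s = 0, where 0 `^ 0 = 1: a sequence of
   sets then also encodes a finite cover. *)
Definition diameter_pow s A : \bar R :=
  if A == set0 then 0 else diameter A `^ s.

Definition hausdorff_premeasure s (delta : R) A : \bar R :=
  ereal_inf [set \sum_(0 <= i <oo) diameter_pow s (F i) |
    F in [set F : (set X)^nat |
      A `<=` \bigcup_i F i /\ ereal_sup (range (diameter \o F)) < delta%:E]].

Definition hausdorff_measure s A : \bar R :=
  lim (hausdorff_premeasure s delta A @[delta --> (0:R)%R^'+]).

Definition hausdorff_dim A : \bar R :=
  ereal_inf [set s%:E | s in [set s : R | (0 <= s)%R /\ hausdorff_measure s A = 0]].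

End hausdorff.

(* Main.v *)
(* Upper bound.  If liminf of the mean distances vanishes, then for every m > 0
   there are arbitrarily long prefixes of (x, y) in which x and y differ at a
   proportion at most 1/m of the indices.  There are about K^n times a small
   exponential such prefixes of length n, and their cylinders have diameter
   K^-n, so the cylinders of length at least N have total s-th power of
   diameters tending to 0 with N, for each s > 1.

   Lower bound.  Let x |-> perturb j x, for j in nat, modify x along blocks
   between consecutive factorials, so that (x, perturb j x) is always a mean
   Li-Yorke pair.  Placing the slices {(x, perturb j x)}, j < m, one after the
   other through base-K expansions gives a map from [0, m[ into MLY which does
   not contract small distances.  A fine enough cover of MLY thus pulls back to
   a cover of [0, m[, and its diameters sum to at least m. *)

Require Import Defs.
From mathcomp Require Import all_boot all_order all_algebra.
From mathcomp Require Import all_classical all_reals all_analysis.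
From mathcomp Require Import ring lra zify.

Set Implicit Arguments.
Unset Strict Implicit.
Unset Printing Implicit Defensive.

Import Order.TTheory GRing.Theory Num.Theory.
Import numFieldNormedType.Exports.

Local Open Scope classical_set_scope.
Local Open Scope ring_scope.

(** * Bounds on lower and upper limits from frequent or eventual inequalities *)

Section limn_esup_einf.
Context {R : realType}.
Implicit Types (u : (\bar R)^nat) (l : \bar R).
Local Open Scope ereal_scope.

Lemma limn_esup_ge u l :
  (forall N, exists2 n, (N <= n)%N & l <= u n) -> l <= limn_esup u.
Proof.
move=> ul; apply: le_ereal_inf_tmp => _ [V [N _ NV] <-].
have [n Nn lun] := ul N; apply: (le_trans lun).
by apply: ereal_sup_ubound; exists n => //; exact: NV.
Qed.

Lemma limn_einf_le u l :
  (forall N, exists2 n, (N <= n)%N & u n <= l) -> limn_einf u <= l.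
Proof.
move=> ul; rewrite leeNl; apply: limn_esup_ge => N.
by have [n Nn un] := ul N; exists n; rewrite ?leeN2.
Qed.

Lemma limn_einf_ge u l N :
  (forall n, (N <= n)%N -> l <= u n) -> l <= limn_einf u.
Proof.
move=> ul; rewrite leeNr; apply: ge_ereal_inf.
exists (ereal_sup ((\- u) @` [set n | (N <= n)%N])).
  by exists [set n | (N <= n)%N] => //; exists N.
by apply: ge_ereal_sup => _ [n /= Nn <-]; rewrite leeN2 ul.
Qed.

End limn_esup_einf.

(** * Covers of [0, m[ and Lebesgue measure *)

Section lebesgue_cover.
Context {R : realType}.
Local Open Scope ereal_scope.

(** The sets [G i] may fail to be measurable, so the trace of each on [0, m[ is enclosed in a closed
    interval of length [d i] starting at its infimum; subadditivity applies to these intervals. *)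
Lemma lebesgue_cover (m : R) (G : (set R)^nat) (d : R^nat) :
  (0 <= m)%R -> (forall i, 0 <= d i)%R ->
  (forall t : R, 0 <= t < m -> exists i, G i t)%R ->
  (forall i (t u : R), 0 <= t < m -> 0 <= u < m -> G i t -> G i u ->
    `|t - u| <= d i)%R ->
  m%:E <= \sum_(0 <= i <oo) (d i)%:E.
Proof.
move=> m0 d0 mG Gd.
pose H i := [set t : R | 0 <= t < m]%R `&` G i.
(* If [H i] is empty, [a i] is a default value and the enclosure below holds vacuously. *)
pose a i := inf (H i).
have HI i : H i `<=` [set` `[a i, a i + d i]%R].
  move=> t Ht; have [t0m Gt] := Ht.
  have lbH : has_lbound (H i).
    by exists 0%R => u [/= /andP[]].
  rewrite /= in_itv/= (ge_inf lbH Ht)/=.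
  rewrite -lerBlDr; apply: lb_le_inf; first by exists t.
  move=> u [u0m Gu]; have := Gd _ _ _ t0m u0m Gt Gu.
  by rewrite ler_norml => /andP[_]; rewrite !lerBlDr addrC.
have mI : [set` `[0%R, m[%R] `<=` \bigcup_i [set` `[a i, a i + d i]%R].
  move=> t; rewrite /= in_itv/= => tm; have [i Gt] := mG _ tm.
  by exists i => //; exact: HI.
have lebE (b : bool) (x : R) : (0 <= x)%R -> forall c,
    lebesgue_measure ([set` Interval (BLeft c) (BSide b (c + x)%R)] : set R) =
    x%:E.
  move=> x0 c; rewrite lebesgue_measure_itv/= lte_fin.
  case: ifPn => [_|]; first by rewrite -EFinB addrC addKr.
  rewrite -leNgt gerDl => x0'.
  by congr EFin; apply/eqP; rewrite eq_le x0 x0'.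
rewrite -(lebE true m m0 0%R) add0r.
have aI i : measurable [set` `[a i, a i + d i]%R] by exact: measurable_itv.
have := measure_sigma_subadditive lebesgue_measure aI (measurable_itv _) mI.
move/le_trans; apply.
apply: lee_nneseries => i *; first exact: measure_ge0.
by rewrite le_eqVlt; apply/orP; left; apply/eqP; exact: lebE.
Qed.

End lebesgue_cover.

(** * Diameters, Hausdorff measure and Hausdorff dimension *)

Section hausdorff_facts.
Context {R : realType} {X : metricType R}.
Implicit Types (A B : set X) (s d : R).
Local Open Scope ereal_scope.

Lemma diameter_ge0 A : 0 <= diameter A.
Proof. by rewrite le_max lexx. Qed.

Lemma diameter_mdist A x y : A x -> A y -> (mdist x y)%:E <= diameter A.
Proof.
move=> Ax Ay; rewrite le_max ereal_sup_ubound ?orbT//.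
by exists x => //; exists y.
Qed.

Lemma diameter_le A d : (0 <= d)%R ->
  (forall x y, A x -> A y -> mdist x y <= d)%R -> diameter A <= d%:E.
Proof.
move=> d0 Ad; rewrite ge_max lee_fin d0/=.
by apply: ge_ereal_sup => _ [x Ax [y Ay <-]]; rewrite lee_fin Ad.
Qed.

Lemma diameter_pow_ge0 s A : 0 <= diameter_pow s A.
Proof. by rewrite /diameter_pow; case: ifP => // _; exact: poweR_ge0. Qed.

(** Lets one lower bound on sums of diameters serve all exponents at most 1. *)
Lemma diameter_le_pow s A : (0 <= s <= 1)%R -> diameter A <= 1 ->
  diameter A <= diameter_pow s A.
Proof.
move=> /andP[s0 s1] A1; rewrite /diameter_pow; case: eqP => [->|_].
  by apply: diameter_le => // x y [].
have := diameter_ge0 A.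
case: (diameter A) A1 => [d||]//; rewrite !lee_fin => d1.
rewrite le_eqVlt => /predU1P[<-|d0]; first exact: powR_ge0.
by rewrite ger1_powR// d0.
Qed.

Lemma diameter_pow_le s A d : (0 <= s)%R -> (0 <= d)%R -> diameter A <= d%:E ->
  diameter_pow s A <= (d `^ s)%:E.
Proof.
move=> s0 d0; rewrite /diameter_pow; case: eqP => [_ _|_].
  by rewrite lee_fin powR_ge0.
have := diameter_ge0 A.
case: (diameter A) => [c||]//; rewrite !lee_fin => c0 cd.
by rewrite ge0_ler_powR// nnegrE.
Qed.

Lemma hausdorff_premeasure_ge0 s d A : 0 <= hausdorff_premeasure s d A.
Proof.
apply: le_ereal_inf_tmp => _ [F _ <-].
by apply: nneseries_ge0 => i _ _; exact: diameter_pow_ge0.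
Qed.

(* The pieces of a fine cover of the image of [f] pull back to sets of at most
   the same diameter, which therefore have total Lebesgue outer measure at
   least [m]. *)
Lemma hausdorff_premeasure_ge (m s d : R) (f : R -> X) A :
  (0 <= m)%R -> (0 <= s <= 1)%R -> (d <= 1)%R ->
  (forall t : R, 0 <= t < m -> A (f t))%R ->
  (forall t u : R, 0 <= t < m -> 0 <= u < m -> mdist (f t) (f u) < d ->
    `|t - u| <= mdist (f t) (f u))%R ->
  m%:E <= hausdorff_premeasure s d A.
Proof.
move=> m0 s01 d1 fA fd; apply: le_ereal_inf_tmp => _ [F [AF Fd] <-].
have diamd i : diameter (F i) < d%:E.
  by apply: le_lt_trans Fd; apply: ereal_sup_ubound; exists i.
have diamE i : (fine (diameter (F i)))%:E = diameter (F i).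
  rewrite fineK// ge0_fin_numE ?diameter_ge0//.
  by rewrite (lt_trans (diamd i)) ?ltry.
apply: (@le_trans _ _ (\sum_(0 <= i <oo) (fine (diameter (F i)))%:E)).
  apply: (@lebesgue_cover _ _ (fun i => f @^-1` F i)) => //.
  - by move=> i; rewrite fine_ge0// diameter_ge0.
  - by move=> t tm; have [i _ Fi] := AF _ (fA _ tm); exists i.
  move=> i t u tm um Ft Fu; have := diameter_mdist Ft Fu => tud.
  have := fd _ _ tm um; rewrite -lte_fin (le_lt_trans tud)// => /(_ isT) tu.
  by rewrite (le_trans tu)// -lee_fin diamE.
apply: lee_nneseries => i; first by rewrite diamE diameter_ge0.
move=> _; rewrite diamE; apply: diameter_le_pow => //.
by rewrite ltW// (lt_le_trans (diamd i)).
Qed.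

Lemma hausdorff_measure_pinfty s A :
  (forall m : nat, \forall d \near (0%R : R)^'+,
     m%:R%:E <= hausdorff_premeasure s d A) ->
  hausdorff_measure s A = +oo.
Proof.
move=> H; apply: cvg_lim => //; apply/cvgeyPge => M.
near=> d; apply: (@le_trans _ _ (Num.truncn M).+1%:R%:E).
  by rewrite lee_fin ltW// truncnS_gt.
by near: d; exact: H.
Unshelve. all: by end_near. Qed.

Lemma hausdorff_measure0 s A :
  (forall d e : R, (0 < d)%R -> (0 < e)%R ->
     hausdorff_premeasure s d A <= e%:E) ->
  hausdorff_measure s A = 0.
Proof.
move=> H; apply: cvg_lim => //; apply: cvg_near_cst.
near=> d; apply/eqP; rewrite eq_le hausdorff_premeasure_ge0 andbT.
by apply/lee_addgt0Pr => e e0; rewrite add0e H.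
Unshelve. all: by end_near. Qed.

Lemma hausdorff_dim1 A :
  (forall s, (0 <= s <= 1)%R -> hausdorff_measure s A = +oo) ->
  (forall s, (1 < s)%R -> hausdorff_measure s A = 0) ->
  hausdorff_dim A = 1.
Proof.
move=> Hlo Hhi; apply/eqP; rewrite eq_le; apply/andP; split.
  apply/lee_addgt0Pr => e e0; apply: ereal_inf_lbound.
  exists (1 + e)%R => //.
  by split; [rewrite addr_ge0// ltW|rewrite Hhi// ltrDl].
apply: le_ereal_inf_tmp => _ [s [s0 sA] <-]; rewrite lee_fin leNgt.
by apply/negP => s1; have := Hlo s; rewrite s0 ltW// sA => /(_ isT).
Qed.

End hausdorff_facts.

(** * Mean distances in the full shift *)

Section fullshift_facts.
Context {R : realType} {K : nat}.
Implicit Types (x y : fullshift R K) (w : seq ('I_K * 'I_K)).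
Local Notation shift := (@shift_map R K).

Lemma fullshift_mdist_ge x y i : x i != y i -> K%:R ^- i <= mdist x y.
Proof.
move=> xy; have xNy : x != y by apply: contraNneq xy => ->.
rewrite /mdist/= /fullshift_dist (negbTE xNy).
have K0 := fullshift_gt0 x.
rewrite lef_pV2 ?posrE ?exprn_gt0//; apply: ler_weXn2l.
  by rewrite -[1]/(1%:R) ler_nat -(ltr0n R).
exact: first_diff_le.
Qed.

Lemma fullshift_mdist_le x y n :
  (forall i, (i < n)%N -> x i = y i) -> mdist x y <= K%:R ^- n.
Proof.
move=> xy; have K0 := fullshift_gt0 x.
rewrite /mdist/= /fullshift_dist; case: ifPn => [_|xNy].
  by rewrite invr_ge0 exprn_ge0// ltW.
rewrite lef_pV2 ?posrE ?exprn_gt0//; apply: ler_weXn2l.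
  by rewrite -[1]/(1%:R) ler_nat -(ltr0n R).
by rewrite leqNgt; apply: contra (first_diff_neq xNy) => /xy ->.
Qed.

Lemma fullshift_mdist_le1 x y : mdist x y <= 1.
Proof. by have := @fullshift_mdist_le x y 0; rewrite expr0 invr1; exact. Qed.

Lemma iter_shift_map x i j : iter i shift x j = x (i + j)%N.
Proof. by elim: i j => //= i IH j; rewrite /shift_map IH addnS. Qed.

(** After [i] shifts a disagreement at index [i] sits at index 0, which puts the points at distance
    1. *)
Lemma mdist_iter_shift_ge x y i :
  (x i != y i)%:R <= mdist (iter i shift x) (iter i shift y).
Proof.
case: (boolP (x i != y i)) => [xy|_]; last exact: mdist_ge0.
have := @fullshift_mdist_ge (iter i shift x) (iter i shift y) 0.
by rewrite !iter_shift_map addn0 expr0 invr1; apply.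
Qed.

Lemma sum_diff_le x y n :
  \sum_(i < n) (x i != y i)%:R <= n%:R * mean_dist shift x y n.
Proof.
have [->|n0] := eqVneq n 0%N; first by rewrite big_ord0 mul0r.
rewrite /mean_dist mulrA divff ?pnatr_eq0// mul1r.
by apply: ler_sum => i _; exact: mdist_iter_shift_ge.
Qed.

(** With S the sum up to [n], the next sum is (S + 1) / K, at most 2 / K <= 1. *)
Lemma sum_geometric_le1 a n : (1 < K)%N ->
  \sum_(a <= i < n) (K%:R : R) ^- (n - i) <= 1.
Proof.
move=> K1; elim: n => [|n IH]; first by rewrite big_geq.
have [an|na] := leqP a n; last by rewrite big_geq.
have K0 : 0 < K%:R :> R by rewrite ltr0n ltnW.
have -> : \sum_(a <= i < n.+1) (K%:R : R) ^- (n.+1 - i) =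
    K%:R^-1 * (\sum_(a <= i < n) (K%:R : R) ^- (n - i) + 1).
  rewrite big_nat_recr//= subSnn expr1 mulrDr mulr1 mulr_sumr; congr (_ + _).
  by apply: eq_big_nat => i /andP[_ /ltnW ni]; rewrite subSn// exprS invfM.
rewrite mulrC ler_pdivrMr// mul1r (@le_trans _ _ 2)//; last by rewrite ler_nat.
by rewrite -[2]/(1 + 1) lerD2r.
Qed.

(** The first [a] distances are at most 1 each. For later [i] the shifted points agree on [n - i]
    indices, so the remaining distances are dominated by a geometric sum. *)
Lemma mean_dist_agree_le x y a n : (1 < K)%N -> (a <= n)%N ->
  (forall i, (a <= i < n)%N -> x i = y i) ->
  mean_dist shift x y n <= n%:R^-1 * (a%:R + 1).
Proof.
move=> K1 an xy; apply: ler_wpM2l; first by rewrite invr_ge0.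
rewrite -(big_mkord xpredT (fun i => mdist (iter i shift x) (iter i shift y))).
rewrite (big_cat_nat (leq0n a) an)//=; apply: lerD.
  rewrite -[a in leRHS]subn0 -sumr_const_nat; apply: ler_sum => i _.
  exact: fullshift_mdist_le1.
apply: le_trans (@sum_geometric_le1 a n K1).
apply: ler_sum_nat => i /andP[ai ni].
apply: fullshift_mdist_le => j jni; rewrite !iter_shift_map; apply: xy.
by rewrite (leq_trans ai) ?leq_addr//= -ltn_subRL.
Qed.

Lemma mean_dist_differ_ge x y a n : (a <= n)%N ->
  (forall i, (a <= i < n)%N -> x i != y i) ->
  n%:R^-1 * (n%:R - a%:R) <= mean_dist shift x y n.
Proof.
move=> an xy; apply: ler_wpM2l; first by rewrite invr_ge0.
rewrite -(big_mkord xpredT (fun i => mdist (iter i shift x) (iter i shift y))).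
rewrite (big_cat_nat (leq0n a) an)//= -[leLHS]add0r; apply: lerD.
  by apply: sumr_ge0 => i _; exact: mdist_ge0.
rewrite -natrB// -sumr_const_nat; apply: ler_sum_nat => i ain.
by have := mdist_iter_shift_ge x y i; rewrite xy.
Qed.

(** Each factorial is negligible compared with the next, so the mean distance at the end of a block
    is governed by that block alone: it is close to 0 after a block of agreement and at least 1/2
    after a block of disagreement. *)
Lemma MLY_factorial_blocks x y k0 : (1 < K)%N ->
  (forall k i, (k0 <= k)%N ->
     ((2 * k)`! <= i < (2 * k).+1`!)%N -> x i != y i) ->
  (forall k i, (k0 <= k)%N ->
     ((2 * k).+1`! <= i < (2 * k).+2`!)%N -> x i = y i) ->
  MLY shift (x, y).
Proof.
move=> K1 xNy xy; split.
  apply/eqP; rewrite eq_le; apply/andP; split; last first.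
    apply: (@limn_einf_ge _ _ _ 0) => n _; rewrite lee_fin mulr_ge0 ?invr_ge0//.
    by apply: sumr_ge0 => i _; exact: mdist_ge0.
  apply/lee_addgt0Pr => e e0; rewrite add0e; apply: limn_einf_le => N.
  (* With f the factorial of 2k+1, the mean is at most (f + 1) / ((2k + 2) f) <= 1 / (k + 1), which
     is below [e] thanks to the last summand. *)
  pose k := (k0 + N + Num.truncn e^-1)%N.
  exists (2 * k).+2`!; first by rewrite (leq_trans _ (fact_geq _))// /k; lia.
  rewrite lee_fin; apply: le_trans.
    apply: mean_dist_agree_le (2 * k).+1`! _ K1 _ _; first exact: leq_fact.
    by move=> i; apply: (xy k); rewrite /k; lia.
  rewrite factS natrM; set f := _`!%:R.
  have f1 : 1 <= f by rewrite ler1n fact_gt0.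
  have ke : e^-1 < k.+1%:R.
    apply: lt_le_trans (truncnS_gt _) _; by rewrite ler_nat ltnS leq_addl.
  have ek : 1 < e * k.+1%:R by rewrite -ltr_pdivrMl// mulr1.
  have -> : ((2 * k).+2%:R : R) = 2 * k.+1%:R.
    by rewrite -natrM; congr _%:R; lia.
  have k1 : 0 < k.+1%:R :> R by [].
  rewrite mulrC ler_pdivrMr; last by rewrite !mulr_gt0//; lra.
  by nra.
apply: (@lt_le_trans _ _ (2^-1)%:E); first by rewrite lte_fin.
apply: limn_esup_ge => N; pose k := (k0 + N).+1.
exists (2 * k).+1`!; first by rewrite (leq_trans _ (fact_geq _))// /k; lia.
rewrite lee_fin; apply: le_trans; last first.
  apply: mean_dist_differ_ge (2 * k)`! _ _ _; first exact: leq_fact.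
  by move=> i; apply: (xNy k); rewrite /k; lia.
rewrite factS natrM; set f := _`!%:R.
have f1 : 1 <= f by rewrite ler1n fact_gt0.
have k3 : 3 <= (2 * k).+1%:R :> R by rewrite ler_nat /k; lia.
rewrite mulrC ler_pdivlMr; last by rewrite mulr_gt0//; lra.
by nra.
Qed.

End fullshift_facts.

Lemma expr_lt_eps (R : realType) (q e : R) : 0 <= q -> q < 1 -> 0 < e ->
  exists n, q ^+ n < e.
Proof.
move=> q0 q1 e0; have q1' : `|q| < 1 by rewrite ger0_norm.
have /cvgrPdist_lt /(_ e e0) [n _ /(_ n (leqnn n))] := cvg_expr q1'.
by rewrite /= sub0r normrN ger0_norm ?exprn_ge0//; exists n.
Qed.

(** * Expansions of reals in base [K.+2] *)

Section base_expansion.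
Context {R : realType} {K : nat}.
Implicit Types t u : R.

Definition digit_rem t : R := K.+2%:R * t - (Num.truncn (K.+2%:R * t))%:R.

Definition digits t : fullshift R K.+2 :=
  fun i => inord (Num.truncn (K.+2%:R * iter i digit_rem t)).

Lemma digit_rem_itv t : 0 <= t -> 0 <= digit_rem t < 1.
Proof.
move=> t0; have /truncn_itv : 0 <= K.+2%:R * t by rewrite mulr_ge0.
by rewrite /digit_rem subr_ge0 ltrBlDl natr1.
Qed.

Lemma iter_digit_rem_itv t i : 0 <= t < 1 -> 0 <= iter i digit_rem t < 1.
Proof.
by move=> t01; elim: i => [//|i /andP[ti0 _]]; exact: digit_rem_itv.
Qed.

Lemma val_digits t i : 0 <= t < 1 ->
  digits t i = Num.truncn (K.+2%:R * iter i digit_rem t) :> nat.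
Proof.
move=> /(@iter_digit_rem_itv _ i) /andP[t0 t1]; rewrite inordK//.
by rewrite truncn_lt_nat ?mulr_ge0// gtr_pMr.
Qed.

(** As long as the digits agree, [digit_rem] multiplies the difference by the base, while remainders
    stay in [0, 1[. *)
Lemma digits_eq_dist t u n : 0 <= t < 1 -> 0 <= u < 1 ->
  (forall i, (i < n)%N -> digits t i = digits u i) ->
  `|t - u| < K.+2%:R ^- n.
Proof.
move=> t01 u01 tu.
have remB : iter n digit_rem t - iter n digit_rem u = K.+2%:R ^+ n * (t - u).
  elim: n tu => [_|n IH tu]; first by rewrite mul1r.
  rewrite exprS -mulrA -IH => [|i /ltnW]; last by apply: tu.
  rewrite /= /digit_rem -!val_digits// (tu n)//; ring.
have := iter_digit_rem_itv n t01; have := iter_digit_rem_itv n u01.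
move=> /andP[un0 un1] /andP[tn0 tn1].
have Kn : 0 < K.+2%:R ^+ n :> R by rewrite exprn_gt0.
rewrite -[_ ^- n]mul1r ltr_pdivlMr// mulrC -[X in X * _](ger0_norm (ltW Kn)).
by rewrite -normrM -remB ltr_norml; lra.
Qed.

Lemma digits_dist t u : 0 <= t < 1 -> 0 <= u < 1 ->
  `|t - u| <= mdist (digits t) (digits u).
Proof.
move=> t01 u01; have [tu|tu] := eqVneq (digits t) (digits u).
  (* Equal expansions put [t] and [u] closer than every power of the inverse base, contradicting
     [tu0]. *)
  rewrite tu mdistxx leNgt; apply/negP => tu0.
  have [] := @expr_lt_eps R K.+2%:R^-1 `|t - u| _ _ tu0; rewrite ?invr_ge0//.
    by rewrite invf_lt1// ltr1n.
  move=> n; rewrite exprVn ltNge => /negP; apply; apply: ltW.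
  by apply: digits_eq_dist => // i _; rewrite tu.
apply: le_trans (fullshift_mdist_ge (first_diff_neq tu)).
apply/ltW/digits_eq_dist => // i; rewrite ltnNge; apply: contraNeq.
exact: first_diff_le.
Qed.

End base_expansion.

(** * Infinite Hausdorff measure for exponents at most 1 *)

Section lower_bound.
Context {R : realType} {K : nat}.
Implicit Types (t u : R) (x : fullshift R K.+2) (i j k : nat).

Definition in_block i := `[< exists k, ((2 * k)`! <= i < (2 * k).+1`!)%N >].

(** Intervals between consecutive factorials are disjoint; membership in two of them would force k <
    l < k + 1. *)
Lemma notin_block k i :
  ((2 * k).+1`! <= i < (2 * k).+2`!)%N -> in_block i = false.
Proof.
move=> /andP[ki ik]; apply/asboolP => -[l /andP[li il]].
have mono m n : (m`! < n`!)%N -> (m < n)%N.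
  by rewrite !ltnNge; apply: contra; exact: leq_fact.
have := mono _ _ (leq_ltn_trans ki il); have := mono _ _ (leq_ltn_trans li ik).
lia.
Qed.

(* The switch at index [j] separates the slices [(x, perturb j x)] for distinct
   [j] without affecting the asymptotics. *)
Definition perturb j x : fullshift R K.+2 :=
  fun i => (x i + (in_block i (+) (i == j))%:R)%R.

(** Addition is modulo [K.+2], where 1 differs from 0. *)
Lemma perturb_eq j x i : (perturb j x i == x i) = ~~ (in_block i (+) (i == j)).
Proof.
rewrite /perturb -subr_eq0 addrC addKr.
by case: (_ (+) _); rewrite ?eqxx ?oner_eq0.
Qed.

Lemma perturb_MLY j x : MLY (@shift_map R K.+2) (x, perturb j x).
Proof.
have jlt k i : (j < k)%N -> ((2 * k)`! <= i)%N -> i == j = false.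
  move=> jk ki; apply/eqP => ij; have := leq_trans (fact_geq _) ki; lia.
apply: (@MLY_factorial_blocks _ _ _ _ j.+1) => // k i jk /[dup] ki /andP[k1 k2].
  rewrite eq_sym perturb_eq (jlt k)// addbF negbK.
  by apply/asboolP; exists k.
apply/esym/eqP; rewrite perturb_eq (notin_block ki) (jlt k)//.
by apply: leq_trans k1; exact: leq_fact.
Qed.

Definition MLY_point t : fullshift R K.+2 * fullshift R K.+2 :=
  let x := digits (t - (Num.truncn t)%:R) in (x, perturb (Num.truncn t) x).

(** Points this close agree in both components on the first [m] indices. Different integer parts
    would show at the index equal to that of [t], where only one of the two perturbations is
    switched. So both points lie in the same slice, and [digits_dist] applies to the first
    components. *)
Lemma MLY_point_dist m t u : 0 <= t < m%:R -> 0 <= u < m%:R ->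
  mdist (MLY_point t) (MLY_point u) < K.+2%:R ^- m ->
  `|t - u| <= mdist (MLY_point t) (MLY_point u).
Proof.
move=> /andP[t0 tm] /andP[u0 um].
rewrite -[mdist _ _]/(Num.max _ _) gt_max => /andP[].
rewrite /MLY_point/=; set x := digits _; set y := digits _ => xy xy'.
have agree (z z' : fullshift R K.+2) i :
    mdist z z' < K.+2%:R ^- m -> (i < m)%N -> z i = z' i.
  move=> zz' im; apply/eqP; apply: contraTT zz' => zNz'; rewrite -leNgt.
  apply: le_trans (fullshift_mdist_ge zNz').
  rewrite lef_pV2 ?posrE ?exprn_gt0//; apply: ler_weXn2l (ltnW im).
  by rewrite ler1n.
have tuE : Num.truncn t = Num.truncn u.
  apply/eqP; apply: contraT => tNu.
  have tlt : (Num.truncn t < m)%N by rewrite truncn_lt_nat.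
  have := agree _ _ _ xy tlt; have := agree _ _ _ xy' tlt.
  rewrite /perturb => + E; rewrite E => /addrI.
  rewrite eqxx (negbTE tNu); case: (in_block _) => /eqP.
    by rewrite eq_sym oner_eq0.
  by rewrite oner_eq0.
rewrite le_max; apply/orP; left.
have -> : t - u = (t - (Num.truncn t)%:R) - (u - (Num.truncn u)%:R).
  by rewrite tuE; ring.
by apply: digits_dist; rewrite subr_ge0 ltrBlDl natr1; exact: truncn_itv.
Qed.

Lemma MLY_hausdorff_measure_le1 s : 0 <= s <= 1 ->
  hausdorff_measure s (MLY (@shift_map R K.+2)) = +oo%E.
Proof.
move=> s01; apply: hausdorff_measure_pinfty => m.
have Km : 0 < K.+2%:R ^- m :> R by rewrite invr_gt0 exprn_gt0.
near=> d; apply: (@hausdorff_premeasure_ge _ _ _ _ _ MLY_point) => //.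
- by near: d; apply: nbhs_right_le.
- by move=> t _; exact: perturb_MLY.
move=> t u tm um tud; apply: (@MLY_point_dist m) => //.
by apply: lt_le_trans tud _; near: d; exact: nbhs_right_le.
Unshelve. all: by end_near. Qed.

End lower_bound.

(** * Sums of multiplicative weights over finite words *)

Section word_sums.
Context {R : realFieldType} {T : finType}.
Variable phi : T -> R.
Hypothesis phi_ge0 : forall a, 0 <= phi a.
Implicit Types (w : seq T) (L : seq (seq T)).

Fixpoint words n : seq (seq T) :=
  if n is n'.+1 then [seq a :: w | a <- enum T, w <- words n'] else [:: [::]].

Lemma mem_words w : w \in words (size w).
Proof.
elim: w => //= a w IH; apply/allpairsP; exists (a, w).
by rewrite mem_enum.
Qed.

Lemma words_uniq n : uniq (words n).
Proof.
elim: n => //= n IH; apply: allpairs_uniq; rewrite ?enum_uniq//.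
by move=> [a w] [b v] _ _ [-> ->].
Qed.

Let weight w := \prod_(a <- w) phi a.

Let weight_ge0 w : 0 <= weight w.
Proof. by apply: prodr_ge0 => a _. Qed.

Lemma sum_weight_words n :
  \sum_(w <- words n) \prod_(a <- w) phi a = (\sum_a phi a) ^+ n.
Proof.
elim: n => [|n IH]; first by rewrite big_seq1 big_nil.
rewrite /= big_allpairs_dep exprS -IH mulr_suml big_enum/=.
apply: eq_bigr => a _; rewrite mulr_sumr; apply: eq_bigr => w _.
by rewrite big_cons.
Qed.

Lemma sum_weight_size_le L n : uniq L ->
  \sum_(w <- L | size w == n) \prod_(a <- w) phi a <= (\sum_a phi a) ^+ n.
Proof.
move=> Lu; rewrite -sum_weight_words -big_filter.
have pe : perm_eq [seq w <- L | size w == n]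
                  [seq w <- words n | (w \in L) && (size w == n)].
  apply: uniq_perm; rewrite ?filter_uniq ?words_uniq// => w.
  rewrite !mem_filter andbC -andbA; case: eqP => [<-|]; rewrite ?andbF//.
  by rewrite mem_words andbT.
rewrite (perm_big _ pe) big_filter/= big_mkcond/=; apply: ler_sum => w _.
by case: ifP => // _; exact: weight_ge0.
Qed.

(** Grouping the words by length bounds the sum by the tail of a geometric series. *)
Lemma sum_weight_le L N : uniq L -> \sum_a phi a < 1 ->
  \sum_(w <- L | (N <= size w)%N) \prod_(a <- w) phi a <=
  (\sum_a phi a) ^+ N / (1 - \sum_a phi a).
Proof.
move=> Lu; set q := \sum_a phi a => q1.
have q0 : 0 <= q by exact: sumr_ge0.
(* [B] is at least [N] and exceeds the length of every word of [L]. *)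
pose B := (N + \sum_(w <- L) (size w).+1)%N.
have LB w : w \in L -> (size w < B)%N.
  move=> wL; rewrite /B (big_rem w)//=; lia.
have -> : \sum_(w <- L | (N <= size w)%N) \prod_(a <- w) phi a =
    \sum_(N <= n < B) \sum_(w <- L | size w == n) \prod_(a <- w) phi a.
  under [RHS]eq_bigr do rewrite big_mkcond.
  rewrite exchange_big big_mkcond/= big_seq [RHS]big_seq.
  apply: eq_bigr => w wL.
  under [RHS]eq_bigr do rewrite eq_sym.
  by rewrite -big_mkcond big_nat1_eq LB// andbT.
apply: (@le_trans _ _ (\sum_(N <= n < B) q ^+ n)).
  by apply: ler_sum => n _; exact: sum_weight_size_le.
rewrite ler_pdivlMr ?subr_gt0// mulr_suml.
under eq_bigr do rewrite mulrBr mulr1 -exprSr.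
rewrite (@telescope_sumr_eq _ _ _ (fun n => - q ^+ n)) ?leq_addr//.
  by rewrite opprK addrC lerBlDr lerDl exprn_ge0.
by move=> n _; rewrite opprK addrC.
Qed.

End word_sums.

(** * Vanishing Hausdorff measure for exponents above 1 *)

Section upper_bound.
Context {R : realType} {K : nat}.
Implicit Types (w : seq ('I_K * 'I_K)) (p : fullshift R K * fullshift R K).

Definition pair_prefix p n : seq ('I_K * 'I_K) :=
  mkseq (fun i => (p.1 i, p.2 i)) n.

Definition cylinder w : set (fullshift R K * fullshift R K) :=
  [set p | pair_prefix p (size w) = w].

Lemma diameter_cylinder w : (diameter (cylinder w) <= (K%:R ^- size w)%:E)%E.
Proof.
apply: diameter_le; first by rewrite invr_ge0 exprn_ge0.
move=> p p' pw p'w; rewrite -[mdist _ _]/(Num.max _ _) ge_max.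
have pp' i : (i < size w)%N -> (p.1 i, p.2 i) = (p'.1 i, p'.2 i).
  move=> iw.
  have := congr1 (fun v => nth (p.1 i, p.2 i) v i) (etrans pw (esym p'w)).
  by rewrite !nth_mkseq.
by apply/andP; split; apply: fullshift_mdist_le => i /pp' [].
Qed.

Definition num_diff w := count (fun a => a.1 != a.2) w.

Lemma num_diff_prefix p n :
  (num_diff (pair_prefix p n))%:R = \sum_(i < n) (p.1 i != p.2 i)%:R :> R.
Proof.
rewrite /num_diff count_map -sum1_count natr_sum big_mkcond/=.
rewrite -(big_mkord xpredT (fun i => (p.1 i != p.2 i)%:R)) /index_iota subn0.
by apply: eq_bigr => i _; case: ifP.
Qed.

Definition sparse m w := (m * num_diff w <= size w)%N.

(** The number of disagreements is at most the sum of the distances. Without long sparse prefixes,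
    the mean distances would eventually stay above 1/m. *)
Lemma MLY_sparse m N p : (0 < m)%N -> MLY (@shift_map R K) p ->
  exists2 n, (N <= n)%N & sparse m (pair_prefix p n).
Proof.
move=> m0 [liminf0 _]; apply: contrapT => nsparse.
have : ((m%:R^-1)%:E <= limn_einf (fun n =>
    (mean_dist (@shift_map R K) p.1 p.2 n)%:E))%E.
  apply: (@limn_einf_ge _ _ _ N.+1) => n Nn; rewrite lee_fin leNgt.
  apply/negP => small; apply: nsparse; exists n; first exact: ltnW.
  have n0 : 0 < n%:R :> R by rewrite ltr0n (leq_ltn_trans _ Nn).
  have m0' : 0 < m%:R :> R by rewrite ltr0n.
  rewrite /sparse size_mkseq -(ler_nat R) natrM num_diff_prefix.
  rewrite mulrC -ler_pdivlMr//; apply: (le_trans (sum_diff_le _ _ _)).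
  by rewrite ler_pM2l// ltW.
by rewrite liminf0 lee_fin leNgt invr_gt0 ltr0n m0.
Qed.

Lemma MLY_hausdorff_measure_gt1 s : (2 <= K)%N -> 1 < s ->
  hausdorff_measure s (MLY (@shift_map R K)) = 0%E.
Proof.
move=> K2 s1; apply: hausdorff_measure0 => d e d0 e0.
have s0 : 0 <= s by rewrite ltW// (lt_trans _ s1).
have K0 : 0 < K%:R :> R by rewrite ltr0n ltnW.
have K1 : 1 < K%:R :> R by rewrite ltr1n.
pose b := K%:R `^ (s - 1) : R.
have b1 : 1 < b.
  have s10 : 0 < s - 1 by rewrite subr_gt0.
  by have := @gt0_ltr_powR R _ s10 1 K%:R; rewrite !nnegrE powR1; apply.
(* The midpoint of 1 and 1/b satisfies both r < 1 and r b > 1. *)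
pose r := (1 + b^-1) / 2.
have bi0 : 0 < b^-1 by rewrite invr_gt0; lra.
have bi1 : b^-1 < 1 by rewrite invf_lt1//; lra.
have bbi : b * b^-1 = 1 by rewrite divff//; lra.
have r0 : 0 < r by rewrite /r; lra.
have r1 : r < 1 by rewrite /r; lra.
have rb1 : 1 < r * b by rewrite /r; nra.
(* This smallness of [rho] is what brings the total letter weight (1 + K rho) / (r b) below 1. *)
have [m0 rm] : exists m, r ^+ m < (r * b - 1) / K%:R.
  by apply: expr_lt_eps; rewrite ?ltW// divr_gt0// subr_gt0.
pose m := m0.+1; pose rho := r ^+ m.
have rho0 : 0 < rho by exact: exprn_gt0.
have rhob : 1 + K%:R * rho < r * b.
  rewrite -ltrBrDl mulrC -ltr_pdivlMr//; apply: le_lt_trans rm.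
  by rewrite /rho exprS ger_pMl ?exprn_gt0// ltW.
pose c := K%:R `^ (- s) / r : R.
have Ks0 : 0 < K%:R `^ (- s) :> R by exact: powR_gt0.
have c0 : 0 < c by rewrite divr_gt0.
(* On sparse words the product of the letter weights [phi] dominates the s-th
   power of the diameter of the cylinder: the gain [r^-1] per letter pays for
   the factor [rho = r ^+ m] at each of the few differences.  Yet the sum of
   [phi] over all letters is less than 1. *)
pose phi (a : 'I_K * 'I_K) : R := c * ((a.1 == a.2)%:R + rho).
have phi_ge0 a : 0 <= phi a by rewrite mulr_ge0 ?addr_ge0// ltW.
have sum_phi : \sum_a phi a = (1 + K%:R * rho) / (r * b).
  rewrite -mulr_sumr -(pair_bigA _ (fun i j : 'I_K => (i == j)%:R + rho))/=.
  under eq_bigr => i _.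
    rewrite big_split/= sumr_const card_ord (bigD1 i)//= eqxx big1 ?addr0.
      over.
    by move=> j /negbTE; rewrite eq_sym => ->.
  rewrite sumr_const card_ord /c /b powRN powRB ?gt_eqF ?implybT//.
  rewrite powRr1 ?ltW// -[rho *+ K]mulr_natl -[(1 + _) *+ K]mulr_natl.
  have := powR_gt0 s K0; move: K0 r0; clearbody rho r.
  move: (K%:R `^ s) K%:R => B k k0 r0 B0; field.
  by rewrite !gt_eqF.
have q1 : \sum_a phi a < 1.
  by rewrite sum_phi ltr_pdivrMr ?mul1r//; apply: lt_trans rb1.
set q := \sum_a phi a in q1.
have q0 : 0 <= q by exact: sumr_ge0.
have weight_ge w : sparse m w -> (K%:R ^- size w) `^ s <= \prod_(a <- w) phi a.
  move=> sw; have : c ^+ size w * rho ^+ num_diff w <= \prod_(a <- w) phi a.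
    rewrite /num_diff; elim: w {sw} => [|a w IH].
      by rewrite big_nil mul1r.
    rewrite big_cons /= exprS exprD mulrACA; apply: ler_pM => //.
    - by rewrite mulr_ge0 ?exprn_ge0// ltW.
    - by rewrite mulr_ge0 ?exprn_ge0// ltW.
    rewrite ler_pM2l//; case: (a.1 == a.2); rewrite ?expr0 ?expr1 ?add0r//.
    by rewrite lerDl ltW.
  apply: le_trans.
  have -> : (K%:R ^- size w) `^ s = K%:R `^ (- s) ^+ size w :> R.
    rewrite -(powR_mulrn _ (ltW Ks0)) -(powR_invn _ (ltW K0)) -!powRrM.
    by rewrite mulNr mulrC mulNr.
  rewrite /c expr_div_n -mulrA ler_peMr ?exprn_ge0 ?powR_ge0// mulrC.
  rewrite ler_pdivlMr ?exprn_gt0// mul1r /rho -exprM.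
  by apply: ler_wiXn2l => //; exact: ltW.
have Ki0 : 0 <= K%:R^-1 :> R by rewrite invr_ge0 ltW.
have Ki1 : K%:R^-1 < 1 :> R by rewrite invf_lt1.
(* Length [N1] makes the cylinders thinner than [d]; length [N2] makes the geometric tail smaller
   than [e]. *)
have [N1 KN] := expr_lt_eps Ki0 Ki1 d0.
have [N2 qN] : exists n, q ^+ n < e * (1 - q).
  by apply: expr_lt_eps => //; rewrite mulr_gt0// subr_gt0.
pose N := maxn N1 N2.
(* The cover consists of the cylinders of long sparse words, enumerated by their codes; all other
   indices receive the empty set, which contributes 0. *)
pose F i : set (fullshift R K * fullshift R K) :=
  if pickle_inv i is Some w then
    if (N <= size w)%N && sparse m w then cylinder w else set0
  else set0.
have diam0 : (diameter (set0 : set (fullshift R K * fullshift R K)) <= 0)%E.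
  by apply: diameter_le.
apply: ge_ereal_inf.
exists (\sum_(0 <= i <oo) diameter_pow s (F i))%E.
  exists F => //; split.
    move=> p pM; have [n Nn sn] := @MLY_sparse m N p isT pM.
    exists (pickle (pair_prefix p n)) => //.
    by rewrite /F pickleK_inv size_mkseq Nn sn /cylinder/= size_mkseq.
  apply: (@le_lt_trans _ _ (K%:R^-1 ^+ N1)%:E); last by rewrite lte_fin.
  apply: ge_ereal_sup => _ [i _ <-]; rewrite /= /F.
  have z : (diameter (set0 : set (fullshift R K * fullshift R K))
    <= (K%:R^-1 ^+ N1)%:E)%E.
    by apply: (le_trans diam0); rewrite lee_fin exprn_ge0.
  case: pickle_inv => [w|//]; case: ifP => // /andP[Nw _].
  apply: (le_trans (diameter_cylinder w)); rewrite lee_fin -exprVn.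
  by apply: ler_wiXn2l (leq_trans (leq_maxl _ _) Nw) => //; exact: ltW.
apply: lime_le.
  by apply: is_cvg_nneseries => i _ _; exact: diameter_pow_ge0.
apply: nearW => M.
pose g w : R := if (N <= size w)%N then \prod_(a <- w) phi a else 0.
have g0 w : 0 <= g w by rewrite /g; case: ifP => // _; exact: prodr_ge0.
apply: (@le_trans _ _ (\sum_(0 <= i < M) oapp g 0 (pickle_inv i))%:E).
  rewrite -sumEFin; apply: lee_sum => i _; rewrite /F.
  have pow0 : diameter_pow s (set0 : set (fullshift R K * fullshift R K)) = 0%E.
    by rewrite /diameter_pow eqxx.
  case: pickle_inv => [w|]; rewrite ?pow0//=.
  case: ifP => [/andP[Nw sw]|_]; last by rewrite pow0 lee_fin.
  rewrite /g Nw; apply: le_trans (_ : _ <= ((K%:R ^- size w) `^ s)%:E)%E _.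
    by apply: diameter_pow_le (diameter_cylinder w) => //.
  by rewrite lee_fin weight_ge.
rewrite lee_fin -big_pmap.
(* Distinct codes decode to distinct words, so a partial sum counts no word twice. *)
have Lu : uniq (pmap (@pickle_inv (seq ('I_K * 'I_K))) (index_iota 0 M)).
  by apply: (pmap_uniq pickle_invK); exact: iota_uniq.
rewrite -big_mkcond; apply: le_trans (sum_weight_le phi_ge0 N Lu q1) _.
rewrite ler_pdivrMr ?subr_gt0//; apply: le_trans (ltW qN).
by apply: ler_wiXn2l => //; [exact: ltW|exact: leq_maxr].
Qed.

End upper_bound.

Theorem corollary1p3 (R : realType) (K : nat) (hK : (2 <= K)%N) :
  hausdorff_dim (MLY (@shift_map R K)) = 1%E /\
  hausdorff_measure 1%R (MLY (@shift_map R K)) = +oo%E.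
Proof.
(* The lower bound is stated for an alphabet ['I_K.+2], which carries the ring structure used by
   [perturb]. *)
case: K hK => [|[|K]]// hK; split; last first.
  by apply: MLY_hausdorff_measure_le1; rewrite ler01 lexx.
apply: hausdorff_dim1 => s; first exact: MLY_hausdorff_measure_le1.
exact: MLY_hausdorff_measure_gt1.
Qed.
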